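(* Let $\mathcal I$ uniformly parameter-interpret a class $\mathcal D$ in a class $\mathcal C$ with arity $r$, and let $\mathcal J$ uniformly parameter-free interpret a class $\mathcal E$ in $\mathcal D$ with arity $q$. If both interpretations are quotient-trace reflecting, then their composite interpretation of $\mathcal E$ in $\mathcal C$ has arity $rq$ and is quotient-trace reflecting.
   Context: $\mathcal C,\mathcal D,\mathcal E$ are classes of finite structures in countable first-order languages $L,L',L''$ respectively (function and constant symbols may be replaced by graph relations). Uniform parameter-interpretation $\mathcal I$ of $\mathcal D$ in $\mathcal C$, of arity $r\ge1$: an injection $\alpha:\mathcal D\to\mathcal C$; an integer $s\ge0$; fixed $L$-formulas $\delta(\bar u;\bar z)$, $\epsilon(\bar u,\bar v;\bar z)$ with $|\bar u|=|\bar v|=r$, $|\bar z|=s$; for each relation symbol $R\in L'$ a fixed $L$-formula $R^{\mathcal I}$ on the appropriate number of $r$-tuples (and $\bar z$); and for each $A\in\mathcal D$ a tuple $\bar c_A\in\alpha(A)^s$ and an $L'$-isomorphism $\iota_A:A\to X_A/E_A$, where $X_A=\delta(\alpha(A)^r;\bar c_A)$ and $E_A$ is the equivalence relation on $X_A$ defined by $\epsilon(\bar u,\bar v;\bar c_A)$; the formulas $R^{\mathcal I}$ (evaluated at $\bar c_A$) are $E_A$-invariant on $X_A$ and induce the $L'$-structure on $X_A/E_A$. It is parameter-free if $s=0$. A representative of $a\in A$ is an element of the class $\iota_A(a)$. Quotient-trace reflecting: for every $m\ge0$ and every parameter-free $L$-formula $\rho(\bar v_1,\dots,\bar v_m;\bar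 z)$ (each $\bar v_i$ an $r$-tuple) such that, for every $A\in\mathcal D$, $\rho(\cdot;\bar c_A)$ is $E_A$-invariant in each $\bar v_i$ on $X_A^m$, there is a parameter-free $L'$-formula $\rho^{\downarrow}(y_1,\dots,y_m)$ such that for every $A\in\mathcal D$, all $a_1,\dots,a_m\in A$ and arbitrary representatives $\bar v_i\in X_A$ of $a_i$: $A\models\rho^{\downarrow}(a_1,\dots,a_m)\iff\alpha(A)\models\rho(\bar v_1,\dots,\bar v_m;\bar c_A)$. Composite interpretation. For $B\in\mathcal E$, let $A\in\mathcal D$ be associated with $B$ by $\mathcal J$ and $M=\alpha(A)\in\mathcal C$ associated with $A$ by $\mathcal I$. A composite representative of an element of $B$ is an $rq$-tuple from $M$ consisting of $q$ blocks in $X_A$ that represent under $\mathcal I$ the coordinates of a $q$-tuple from $A$ representing that element under $\mathcal J$. The domain, equivalence and relation formulas are the translations of those of $\mathcal J$ through $\mathcal I$; the interpretation parameters are those of $\mathcal I$. *)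

(* Defs.v *)
From HB Require Import structures.
From mathcomp Require Import all_boot.
From mathcomp Require Import boolp classical_sets functions cardinality.

Set Implicit Arguments.
Unset Strict Implicit.
Unset Printing Implicit Defensive.

Local Open Scope classical_set_scope.

(* Countable languages are relational: an n-ary function symbol is given by its
   (n+1)-ary graph relation, a constant symbol by a unary relation. *)
Record language := Language {
  symbol : countType;
  arity : symbol -> nat }.

(* An n-tuple of elements of T is a function 'I_n -> T. *)
Record structure (L : language) := Structure {
  carrier :> Type;
  rel_of : forall R : symbol L, set ('I_(arity R) -> carrier);
  carrier_finite : finite_set [set: carrier] }.

(* First-order formulas whose free variables are indexed by the type V.
   [fEx] binds the variable [None] of its argument.  Template polymorphism is
   off because it breaks unification when V lives in Set. *)
#[universes(template=no)]
Inductive formula (L : language) (V : Type) : Type :=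
| fTrue : formula L V
| fEq : V -> V -> formula L V
| fRel : forall R : symbol L, ('I_(arity R) -> V) -> formula L V
| fNot : formula L V -> formula L V
| fAnd : formula L V -> formula L V -> formula L V
| fEx : formula L (option V) -> formula L V.

Arguments fTrue {L V}.
Arguments fRel {L V}.

Definition extend V T (e : V -> T) (x : T) : option V -> T :=
  fun o => if o is Some v then e v else x.

Fixpoint sat L (M : structure L) V (phi : formula L V) : set (V -> M) :=
  match phi with
  | fTrue => fun=> True
  | fEq x y => fun e => e x = e y
  | fRel R t => fun e => rel_of (e \o t)
  | fNot p => fun e => ~ sat p e
  | fAnd p1 p2 => fun e => sat p1 e /\ sat p2 e
  | fEx p => fun e => exists x : M, sat p (extend e x)
  end.

Arguments sat {L} M {V} phi _.

Fixpoint rename L V W (f : V -> W) (phi : formula L V) : formula L W :=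
  match phi with
  | fTrue => fTrue
  | fEq x y => fEq L (f x) (f y)
  | fRel R t => fRel R (f \o t)
  | fNot p => fNot (rename f p)
  | fAnd p1 p2 => fAnd (rename f p1) (rename f p2)
  | fEx p => fEx (rename (omap f) p)
  end.

Definition fBigAnd L V n (phi : 'I_n -> formula L V) : formula L V :=
  foldr (fun i p => fAnd (phi i) p) fTrue (enum 'I_n).

(* [fExn n phi] is the n-fold existential quantification of the variables
   [inr i] of [phi]. *)
Definition shift_var V n (x : V + 'I_n.+1) : option (V + 'I_n) :=
  match x with
  | inl v => Some (inl v)
  | inr i => omap inr (unlift ord0 i)
  end.

Definition drop_vars V (x : V + 'I_0) : V :=
  match x with
  | inl v => v
  | inr i => False_rect V (notF (valP i))
  end.

Fixpoint fExn L V n : formula L (V + 'I_n) -> formula L V :=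
  match n return formula L (V + 'I_n) -> formula L V with
  | 0 => rename (@drop_vars V)
  | n'.+1 => fun phi => fExn (fEx (rename (@shift_var V n') phi))
  end.

Definition join V W T (f : V -> T) (g : W -> T) (x : V + W) : T :=
  match x with inl v => f v | inr w => g w end.

(* Data of a uniform parameter-interpretation of the class D in the class C,
   of arity r and with s parameters.  Elements of the quotient X_A / E_A are
   equivalence classes, that is, sets of r-tuples.  A formula on m tuples of
   length r has variables 'I_m * 'I_r. *)
Record interp (L L' : language) (C : set (structure L))
    (D : set (structure L')) (r s : nat) := Interp {
  alpha : D -> C;
  delta : formula L ('I_r + 'I_s);
  epsilon : formula L (('I_r + 'I_r) + 'I_s);
  rel_formula : forall R : symbol L', formula L ('I_(arity R) * 'I_r + 'I_s);
  param : forall A : D, 'I_s -> val (alpha A);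
  iso : forall A : D, val A -> set ('I_r -> val (alpha A)) }.

Arguments iso {L L' C D r s} _ {A} _ _.

Section Interpretation.
Context {L L' : language} {C : set (structure L)} {D : set (structure L')}.
Context {r s : nat} (I : interp C D r s).
Implicit Types A : D.

Definition host A : structure L := val (alpha I A).

Definition domain A : set ('I_r -> host A) :=
  [set u : 'I_r -> host A | sat (host A) (delta I) (join u (param I A))].

Definition equivalent A (u v : 'I_r -> host A) : Prop :=
  sat (host A) (epsilon I) (join (join u v) (param I A)).

(* The value of rho(v_1, ..., v_m; c_A). *)
Definition holds A m (rho : formula L ('I_m * 'I_r + 'I_s))
    (v : 'I_m -> 'I_r -> host A) : Prop :=
  sat (host A) rho (join (fun p => v p.1 p.2) (param I A)).

(* E_A-invariance on X_A^m, one argument at a time. *)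
Definition class_invariant A m (P : set ('I_m -> 'I_r -> host A)) : Prop :=
  forall (i : 'I_m) (v w : 'I_m -> 'I_r -> host A),
    (forall j, domain (v j)) -> (forall j, domain (w j)) ->
    (forall j, j != i -> v j = w j) -> equivalent (v i) (w i) ->
    (P v <-> P w).

Definition eclass A (u : 'I_r -> host A) : set ('I_r -> host A) :=
  [set v | domain v /\ equivalent u v].

Definition quotient A : set (set ('I_r -> host A)) :=
  [set eclass u | u in @domain A].

(* The relation induced by rel_formula R on X_A / E_A. *)
Definition quotient_rel A (R : symbol L')
    (S : 'I_(arity R) -> set ('I_r -> host A)) : Prop :=
  exists v : 'I_(arity R) -> 'I_r -> host A,
    (forall i, S i (v i)) /\ holds (rel_formula I R) v.

Record is_interpretation : Prop := IsInterpretation {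
  arity_gt0 : 0 < r;
  alpha_inj : injective (alpha I);
  equivalent_refl : forall A (u : 'I_r -> host A),
    domain u -> equivalent u u;
  equivalent_sym : forall A (u v : 'I_r -> host A),
    domain u -> domain v -> equivalent u v -> equivalent v u;
  equivalent_trans : forall A (u v w : 'I_r -> host A),
    domain u -> domain v -> domain w ->
    equivalent u v -> equivalent v w -> equivalent u w;
  rel_formula_invariant : forall A (R : symbol L'),
    class_invariant (@holds A _ (rel_formula I R));
  iso_bij : forall A, set_bij [set: val A] (@quotient A) (iso I (A := A));
  iso_rel : forall A (R : symbol L') (a : 'I_(arity R) -> val A),
    rel_of a <-> quotient_rel (fun i => iso I (a i)) }.

Definition quotient_trace_reflecting : Prop :=
  forall (m : nat) (rho : formula L ('I_m * 'I_r + 'I_s)),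
    (forall A, class_invariant (@holds A m rho)) ->
    exists rho_down : formula L' 'I_m,
      forall A (a : 'I_m -> val A) (v : 'I_m -> 'I_r -> host A),
        (forall i, iso I (a i) (v i)) ->
        (sat (val A) rho_down a <-> holds rho v).

(* Translation of an L'-formula: each variable x becomes the r variables
   (x, k), and quantifiers are relativised to the domain formula. *)
Fixpoint translate V (phi : formula L' V) : formula L (V * 'I_r + 'I_s) :=
  match phi with
  | fTrue => fTrue
  | fEq x y => rename (fun z => match z with
                     | inl (inl k) => inl (x, k)
                     | inl (inr k) => inl (y, k)
                     | inr l => inr l
                     end) (epsilon I)
  | fRel R t => rename (fun z => match z with
                     | inl (i, k) => inl (t i, k)
                     | inr l => inr l
                     end) (rel_formula I R)
  | fNot p => fNot (translate p)
  | fAnd p1 p2 => fAnd (translate p1) (translate p2)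
  | fEx p => fExn (fAnd
      (rename (fun z => match z with
                     | inl k => inr k
                     | inr l => inl (inr l)
                     end) (delta I))
      (rename (fun z => match z with
                     | inl (Some x, k) => inl (inl (x, k))
                     | inl (None, k) => inr k
                     | inr l => inl (inr l)
                     end) (translate p)))
  end.

End Interpretation.

Lemma block_index_subproof r q (j : 'I_q) (k : 'I_r) : j * r + k < r * q.
Proof.
apply: (@leq_trans (j.+1 * r)).
  by rewrite mulSn addnC ltn_add2r.
by rewrite mulnC leq_mul2l ltn_ord orbT.
Qed.

(* An rq-tuple consists of q consecutive blocks of length r. *)
Definition block_index r q (j : 'I_q) (k : 'I_r) : 'I_(r * q) :=
  Ordinal (block_index_subproof j k).

Definition block r q T (w : 'I_(r * q) -> T) (j : 'I_q) : 'I_r -> T :=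
  fun k => w (block_index j k).

Section Composite.
Context {L L' L'' : language} {C : set (structure L)} {D : set (structure L')}.
Context {E : set (structure L'')} {r s q : nat}.
Context (I : interp C D r s) (J : interp D E q 0).

(* Translation through I of a formula of J; the k-th copy of the variable x is
   placed at [place x k], and 'I_0 indexes the absent parameters of J. *)
Definition translate_blocks V W (place : V -> 'I_r -> W)
    (phi : formula L' (V + 'I_0)) : formula L (W + 'I_s) :=
  rename (fun z => match z with
            | inl (x, k) => inl (place (drop_vars x) k)
            | inr l => inr l
            end) (translate I phi).

Definition composite_delta : formula L ('I_(r * q) + 'I_s) :=
  fAnd (fBigAnd (fun j : 'I_q =>
          rename (fun z => match z with
                     | inl k => inl (block_index j k)
                     | inr l => inr l
                     end) (delta I)))
       (translate_blocks (@block_index r q) (delta J)).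

Definition composite_epsilon : formula L (('I_(r * q) + 'I_(r * q)) + 'I_s) :=
  translate_blocks (fun x k => match x with
                      | inl j => inl (block_index j k)
                      | inr j => inr (block_index j k)
                      end) (epsilon J).

Definition composite_rel (R : symbol L'') :
    formula L ('I_(arity R) * 'I_(r * q) + 'I_s) :=
  translate_blocks (fun x k => (x.1, block_index x.2 k)) (rel_formula J R).

Definition composite_rep (B : E) (b : val B) :
    set ('I_(r * q) -> host I (alpha J B)) :=
  [set w | exists a : 'I_q -> host J B,
     iso J b a /\ forall j, iso I (a j) (block w j)].

Definition composite : interp C E (r * q) s := {|
  alpha := fun B => alpha I (alpha J B);
  delta := composite_delta;
  epsilon := composite_epsilon;
  rel_formula := composite_rel;
  param := fun B => param I (alpha J B);
  iso := composite_rep |}.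

End Composite.

(* Main.v *)
(* An element of A in D is named by its representatives in the host, and an
   L'-formula at elements of A agrees with its translation at representatives
   (translateP).  So the data of the composite at blocks of representatives
   agree with the data of J at the elements represented, and the axioms for J
   transfer.  A formula rho that is invariant for the composite is read as a
   formula on mq many r-tuples, saturated under the equivalence of I, and pushed
   down to D by the reflection property of I; the result is invariant for J
   because it agrees with rho at composite representatives, so the reflection
   property of J pushes it down to E. *)
Require Import Defs.
From mathcomp Require Import all_boot classical_sets.
From mathcomp Require Import boolp.

Set Implicit Arguments.
Unset Strict Implicit.
Unset Printing Implicit Defensive.

Local Open Scope classical_set_scope.

(** * Semantics of renaming, finite conjunctions and blocks of existential quantifiers *)

Section Satisfaction.
Context {L : language} (M : structure L).

Lemma eq_sat V (phi : formula L V) (e e' : V -> M) :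
  e =1 e' -> sat M phi e <-> sat M phi e'.
Proof. by move=> /funext ->. Qed.

Lemma sat_rename V W (f : V -> W) (phi : formula L V) (e : W -> M) :
  sat M (rename f phi) e <-> sat M phi (e \o f).
Proof.
elim: phi W f e => {V} [V|V x y|V R t|V p IHp|V p IHp p2 IH2|V p IHp] W f e //=.
- by rewrite IHp.
- by rewrite IHp IH2.
- have bodyE x : sat M (rename (omap f) p) (extend e x) <->
      sat M p (extend (e \o f) x).
    by rewrite IHp; apply: eq_sat => -[].
  by split=> -[x /bodyE px]; exists x.
Qed.

Lemma sat_fBigAnd V n (phi : 'I_n -> formula L V) (e : V -> M) :
  sat M (fBigAnd phi) e <-> forall i, sat M (phi i) e.
Proof.
rewrite /fBigAnd; suff H (s : seq 'I_n) :
    sat M (foldr (fun i p => fAnd (phi i) p) fTrue s) e <->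
    forall i, i \in s -> sat M (phi i) e.
  by rewrite H; split=> He i; [apply: He; rewrite mem_enum | move=> _].
elim: s => [|j s IHs] /=; first by split.
rewrite IHs; split=> [[phij phis] i|H].
  by rewrite inE => /predU1P[->|/phis].
by split=> [|i si]; apply: H; rewrite inE ?eqxx ?si ?orbT.
Qed.

Lemma sat_fExn V n (phi : formula L (V + 'I_n)) (e : V -> M) :
  sat M (fExn phi) e <-> exists g : 'I_n -> M, sat M phi (join e g).
Proof.
elim: n phi => [|n IHn] phi /=.
  have no_var (g : 'I_0 -> M) :
      sat M (rename (@drop_vars V) phi) e <-> sat M phi (join e g).
    by rewrite sat_rename; apply: eq_sat => -[|[]].
  split=> [H|[g]]; last by move/no_var.
  (* The structure may be empty, so the assignment comes from the emptiness of ['I_0], not from a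
     default element. *)
  pose g (i : 'I_0) : M := False_rect M (notF (valP i)).
  by exists g; apply/no_var.
(* Index [ord0] is bound by the innermost quantifier, with witness [x]; the assignment [g] of the
   outer quantifiers covers the indices [lift ord0 j]. *)
rewrite IHn; split=> /= [[g [x]]|[g phig]].
  rewrite sat_rename => phix; exists (fun i => extend g x (unlift ord0 i)).
  move: phix; apply: iffLR; apply: eq_sat => -[v //|i] /=.
  by case: (unlift _ _).
exists (g \o lift ord0), (g ord0); rewrite sat_rename.
move: phig; apply: iffLR; apply: eq_sat => -[v //|i] /=.
by case: unliftP => [j ->|->].
Qed.

(** [fExn] for variables indexed by any finite type, so that a whole family of r-tuples, indexed by
    pairs, can be quantified at once. *)
Definition fExfin V (K : finType) (phi : formula L (V + K)) : formula L V :=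
  fExn (rename (fun x => match x with
                  | inl v => inl v
                  | inr k => inr (enum_rank k)
                  end) phi).

Lemma sat_fExfin V (K : finType) (phi : formula L (V + K)) (e : V -> M) :
  sat M (fExfin phi) e <-> exists g : K -> M, sat M phi (join e g).
Proof.
rewrite sat_fExn; split=> -[g].
  rewrite sat_rename => phig; exists (g \o enum_rank); move: phig.
  by apply: iffLR; apply: eq_sat => -[].
move=> phig; exists (g \o enum_val); rewrite sat_rename; move: phig.
by apply: iffLR; apply: eq_sat => -[v //|k] /=; rewrite enum_rankK.
Qed.

End Satisfaction.

(** * Representatives of elements, and truth of translated formulas *)

Section Representatives.
Context {L L' : language} {C : set (structure L)} {D : set (structure L')}.
Context {r s : nat} {I : interp C D r s} (hI : is_interpretation I).
Context {A : D}.
Implicit Types (a b : val A) (u v : 'I_r -> host I A).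

Lemma iso_eclass a : exists2 u, domain u & iso I a = eclass u.
Proof.
have [isoA _ _] := iso_bij hI A.
by have [u Du <-] := isoA a Logic.I; exists u.
Qed.

Lemma iso_domain a u : iso I a u -> domain u.
Proof. by have [v _ ->] := iso_eclass a; case. Qed.

Lemma iso_nonempty a : exists u, iso I a u.
Proof.
have [u Du ->] := iso_eclass a; exists u; split=> //.
exact: equivalent_refl hI _ _ Du.
Qed.

Lemma domain_iso u : domain u -> exists a, iso I a u.
Proof.
move=> Du; have [_ _ isoA] := iso_bij hI A.
have [|a _ Ea] := isoA (eclass u); first by exists u.
by exists a; rewrite Ea; split=> //; apply: equivalent_refl hI _ _ Du.
Qed.

(** Both values of [iso] are equivalence classes, so equivalent members make the classes equal as
    sets, and injectivity of [iso] identifies the elements. *)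
Lemma iso_equivalent a b u v :
  iso I a u -> iso I b v -> equivalent u v <-> a = b.
Proof.
have [x Dx Ea] := iso_eclass a; have [y Dy Eb] := iso_eclass b.
rewrite Ea Eb => -[Du xu] [Dv yv]; split=> [uv|ab]; last first.
  have [_ xv] : eclass x v by rewrite -Ea ab Eb.
  apply: (equivalent_trans hI Du Dx Dv _ xv).
  exact: equivalent_sym hI _ _ _ Dx Du xu.
have [_ isoA _] := iso_bij hI A; apply: isoA; rewrite ?inE //.
have xy : equivalent x y.
  apply: (equivalent_trans hI Dx Du Dy xu).
  apply: (equivalent_trans hI Du Dv Dy uv).
  exact: equivalent_sym hI _ _ _ Dy Dv yv.
have yx := equivalent_sym hI Dx Dy xy.
rewrite Ea Eb; apply/seteqP; split=> w [Dw H]; split=> //.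
  exact: equivalent_trans hI _ _ _ _ Dy Dx Dw yx H.
exact: equivalent_trans hI _ _ _ _ Dx Dy Dw xy H.
Qed.

Lemma iso_inj a b u : iso I a u -> iso I b u -> a = b.
Proof.
move=> au bu; apply/(iso_equivalent au bu).
exact: equivalent_refl hI _ _ (iso_domain au).
Qed.

Lemma iso_transfer a u v : iso I a u -> domain v -> equivalent u v -> iso I a v.
Proof.
move=> au /domain_iso[b bv] uv.
by have /(iso_equivalent au bv) -> := uv.
Qed.

(** [class_invariant] moves a single argument. The hybrids [h k], which take the first [k] arguments
    from [w] and the rest from [v], lead from [v] to [w] in [m] such moves. *)
Lemma class_invariant_all m (P : set ('I_m -> 'I_r -> host I A))
    (v w : 'I_m -> 'I_r -> host I A) :
  class_invariant P -> (forall i, domain (v i)) -> (forall i, domain (w i)) ->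
  (forall i, equivalent (v i) (w i)) -> P v <-> P w.
Proof.
move=> invP Dv Dw vw.
pose h k : 'I_m -> 'I_r -> host I A := fun i => if i < k then w i else v i.
have Dh k i : domain (h k i) by rewrite /h; case: ifP.
have Ph k : P v <-> P (h k).
  elim: k => [|k ->]; first by rewrite (_ : h 0 = v).
  (* Once [k] reaches [m] every argument has been replaced, and [h k] no longer changes. *)
  have [lt_km|le_mk] := ltnP k m; last first.
    rewrite (_ : h k = h k.+1) //; apply/funext => i; rewrite /h.
    by have lt_ik := leq_trans (ltn_ord i) le_mk; rewrite ltnS lt_ik ltnW.
  apply: (invP (Ordinal lt_km)) => // [j neq_jk|].
    rewrite /h ltnS (leq_eqVlt j) (_ : (j == k :> nat) = false) //.
    exact: negbTE neq_jk.
  by rewrite /h /= ltnn ltnSn.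
rewrite (Ph m) (_ : h m = w) //; apply/funext => i.
by rewrite /h ltn_ord.
Qed.

(** [iso_rel] yields only some choice of representatives; invariance of the relation formula carries
    the truth value to the given ones. *)
Lemma rel_formulaP (R : symbol L') (a : 'I_(arity R) -> val A)
    (v : 'I_(arity R) -> 'I_r -> host I A) :
  (forall i, iso I (a i) (v i)) -> rel_of a <-> holds (rel_formula I R) v.
Proof.
move=> av; rewrite (iso_rel hI); split=> [[w [aw]]|hv]; last by exists v.
apply: iffLR; apply: class_invariant_all.
- exact: rel_formula_invariant.
- by move=> i; apply: iso_domain (aw i).
- by move=> i; apply: iso_domain (av i).
- by move=> i; apply/(iso_equivalent (aw i) (av i)).
Qed.

(** Induction on the formula. Equality becomes equivalence of representatives; in the quantifier
    case, the tuples in the domain are exactly the representatives of elements, so the relativised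
    quantifier ranges over all of [A]. *)
Lemma translateP V (phi : formula L' V) (a : V -> val A)
    (v : V -> 'I_r -> host I A) :
  (forall x, iso I (a x) (v x)) ->
  sat (host I A) (translate I phi) (join (fun p => v p.1 p.2) (param I A)) <->
  sat (val A) phi a.
Proof.
elim: phi a v => {V} [V|V x y|V R t|V p IHp|V p1 IH1 p2 IH2|V p IHp] a v av //=.
- rewrite sat_rename -(iso_equivalent (av x) (av y)).
  by apply: eq_sat => -[[]|].
- rewrite sat_rename (rel_formulaP (v := v \o t)); last by move=> i; apply: av.
  by apply: eq_sat => -[[]|].
- by rewrite (IHp a).
- by rewrite (IH1 a) ?(IH2 a).
- have bodyE (b : val A) g : iso I b g ->
      sat (host I A) (rename (fun z => match z with
                     | inl (Some x, k) => inl (inl (x, k))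
                     | inl (None, k) => inr k
                     | inr l => inl (inr l)
                     end) (translate I p))
        (join (join (fun p => v p.1 p.2) (param I A)) g) <->
      sat (val A) p (extend a b).
    move=> bg; rewrite -(IHp _ (extend v g)); last by case.
    by rewrite sat_rename; apply: eq_sat => -[[[]]|].
  have deltaE (g : 'I_r -> host I A) :
      sat (host I A) (rename (fun z => match z with
                     | inl k => inr k
                     | inr l => inl (inr l)
                     end) (delta I))
        (join (join (fun p => v p.1 p.2) (param I A)) g) <-> domain g.
    by rewrite sat_rename; apply: eq_sat => -[].
  rewrite sat_fExn; split=> [[g /= [/deltaE/domain_iso[b bg]]]|[b pb]].
    by move/(bodyE _ _ bg) => pb; exists b.
  have [g bg] := iso_nonempty b; exists g; split; last exact/(bodyE _ _ bg).
  exact/deltaE/(iso_domain bg).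
Qed.

End Representatives.

(** * Saturation of a formula under the equivalence of [I] *)

Section Saturation.
Context {L L' : language} {C : set (structure L)} {D : set (structure L')}.
Context {r s m : nat} (I : interp C D r s).
Context (rho : formula L ('I_m * 'I_r + 'I_s)).

Definition saturate_body :
    formula L (('I_m * 'I_r + 'I_s) + 'I_m * 'I_r) :=
  fAnd
    (fBigAnd (fun i : 'I_m => fAnd
      (rename (fun z => match z with
                 | inl k => inr (i, k)
                 | inr l => inl (inr l)
                 end) (delta I))
      (rename (fun z => match z with
                 | inl (inl k) => inl (inl (i, k))
                 | inl (inr k) => inr (i, k)
                 | inr l => inl (inr l)
                 end) (epsilon I))))
    (rename (fun z => match z with
               | inl p => inr p
               | inr l => inl (inr l)
               end) rho).

(* rho may fail to be invariant on those A in D that do not come from a B in E;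
   quantifying over equivalent tuples restores invariance everywhere. *)
Definition saturate : formula L ('I_m * 'I_r + 'I_s) := fExfin saturate_body.

Lemma sat_saturate_body (A : D) (v : 'I_m -> 'I_r -> host I A)
    (g : 'I_m * 'I_r -> host I A) :
  let w i k := g (i, k) in
  sat (host I A) saturate_body
    (join (join (fun p => v p.1 p.2) (param I A)) g) <->
  (forall i, domain (w i) /\ equivalent (v i) (w i)) /\ holds rho w.
Proof.
move=> w; rewrite /saturate_body /= sat_fBigAnd.
have rhoE : sat (host I A) (rename (fun z => match z with
               | inl p => inr p
               | inr l => inl (inr l)
               end) rho)
    (join (join (fun p => v p.1 p.2) (param I A)) g) <-> holds rho w.
  by rewrite sat_rename; apply: eq_sat => -[[]|].
rewrite rhoE; split=> -[H hw]; split=> // i; have := H i => /=;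
  rewrite !sat_rename => -[d e]; split; [move: d | move: e | move: d | move: e];
  by apply: iffLR; apply: eq_sat => -[[]|] //.
Qed.

Lemma holds_saturate (A : D) (v : 'I_m -> 'I_r -> host I A) :
  holds saturate v <->
  exists w : 'I_m -> 'I_r -> host I A,
    (forall i, domain (w i) /\ equivalent (v i) (w i)) /\ holds rho w.
Proof.
rewrite /holds sat_fExfin; split=> [[g /sat_saturate_body]|[w vw]].
  by exists (fun i k => g (i, k)).
by exists (fun p => w p.1 p.2); apply/sat_saturate_body.
Qed.

(** A witness for [v] is also a witness for [w], by symmetry and transitivity of the equivalence. *)
Lemma saturate_invariant (hI : is_interpretation I) (A : D) :
  class_invariant (@holds _ _ _ _ _ _ I A m saturate).
Proof.
move=> i.
suff H (v w : 'I_m -> 'I_r -> host I A) :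
    (forall j, domain (v j)) -> (forall j, domain (w j)) ->
    (forall j, j != i -> v j = w j) -> equivalent (v i) (w i) ->
    holds saturate v -> holds saturate w.
  move=> v w Dv Dw vw vwi; split; apply: H => //.
    by move=> j /vw.
  exact: equivalent_sym hI _ _ _ _ _ vwi.
move=> Dv Dw vw vwi /holds_saturate[x [vx hx]]; apply/holds_saturate.
exists x; split=> // j; have [Dx vxj] := vx j; split=> //.
have [->|/vw <-//] := eqVneq j i.
have [Dxi vxi] := vx i; apply: (equivalent_trans hI (Dw i) (Dv i) Dxi _ vxi).
exact: equivalent_sym hI _ _ _ _ _ vwi.
Qed.

End Saturation.

(** * Cutting an rq-tuple into blocks *)

Section Blocks.
Context {r q : nat}.

(** Division with remainder by [r] recovers [j] and [k] from [j * r + k], and an injection between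
    finite sets of equal size is a bijection. *)
Lemma block_index_bij : exists2 g : 'I_(r * q) -> 'I_q * 'I_r,
  forall j k, g (block_index j k) = (j, k) &
  forall i, block_index (g i).1 (g i).2 = i.
Proof.
pose f (p : 'I_q * 'I_r) := block_index p.1 p.2.
have f_inj : injective f.
  move=> [j k] [j' k'] /(congr1 val) /= E.
  have r_gt0 : 0 < r by apply: leq_ltn_trans (ltn_ord k).
  have := congr1 (divn^~ r) E; have := congr1 (modn^~ r) E.
  rewrite /= !modnMDl !divnMDl // !modn_small // !divn_small // !addn0.
  by move=> /val_inj -> /val_inj ->.
have [|g fK gK] := inj_card_bij f_inj.
  by rewrite card_prod !card_ord mulnC.
by exists g => [j k|i]; [apply: (fK (j, k)) | apply: gK].
Qed.

Lemma block_surj T (u : 'I_q -> 'I_r -> T) :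
  exists w : 'I_(r * q) -> T, forall j, block w j = u j.
Proof.
have [g gK _] := block_index_bij.
exists (fun i => u (g i).1 (g i).2) => j.
by apply/funext => k; rewrite /block gK.
Qed.

End Blocks.

(** * Transfer of data between blocks of representatives and the elements represented *)

Section Composite.
Context {L L' L'' : language} {C : set (structure L)} {D : set (structure L')}.
Context {E : set (structure L'')} {r s q : nat}.
Context {I : interp C D r s} {J : interp D E q 0}.
Context (hI : is_interpretation I) (hJ : is_interpretation J).
Implicit Types B : E.

Let IJ : interp C E (r * q) s := composite I J.

(** The [I]-half of [composite_rep]: the tuple from the middle structure is kept explicit. *)
Definition blocks_rep B (a : 'I_q -> host J B)
    (w : 'I_(r * q) -> host IJ B) : Prop :=
  forall j, @iso _ _ _ _ _ _ I (alpha J B) (a j) (block w j).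

Lemma blocks_rep_surj B (a : 'I_q -> host J B) :
  exists w : 'I_(r * q) -> host IJ B, blocks_rep a w.
Proof.
have [u au] := choice (fun j => iso_nonempty hI (a j)).
have [w wu] := block_surj u.
by exists w => j; rewrite wu.
Qed.

Lemma blocks_rep_inj B (a a' : 'I_q -> host J B) (w : 'I_(r * q) -> host IJ B) :
  blocks_rep a w -> blocks_rep a' w -> a = a'.
Proof. by move=> aw aw'; apply/funext => j; apply: iso_inj (aw j) (aw' j). Qed.

Lemma translate_blocksP B V W (place : V -> 'I_r -> W)
    (phi : formula L' (V + 'I_0)) (a : V -> host J B) (e : W -> host IJ B) :
  (forall x, @iso _ _ _ _ _ _ I (alpha J B) (a x) (fun k => e (place x k))) ->
  sat (host IJ B) (translate_blocks I place phi) (join e (param IJ B)) <->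
  sat (host J B) phi (join a (param J B)).
Proof.
move=> ae; rewrite /translate_blocks sat_rename.
rewrite -(translateP hI phi
  (v := fun x k => e (place (drop_vars x) k))); last first.
  (* [J] has no parameters, so every variable of [phi] comes from [V]. *)
  by case=> [x|[//]]; apply: ae.
by apply: eq_sat => -[[]|].
Qed.

Lemma composite_domain B (w : 'I_(r * q) -> host IJ B) :
  domain w <-> exists2 a : 'I_q -> host J B, blocks_rep a w & domain a.
Proof.
have deltaE a : blocks_rep a w ->
    sat (host IJ B) (translate_blocks I (@block_index r q) (delta J))
      (join w (param IJ B)) <-> domain a.
  exact: translate_blocksP.
have blockE : sat (host IJ B) (fBigAnd (fun j : 'I_q =>
          rename (fun z => match z with
                     | inl k => inl (block_index j k)
                     | inr l => inr l
                     end) (delta I))) (join w (param IJ B)) <->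
    forall j, @domain _ _ _ _ _ _ I (alpha J B) (block w j).
  rewrite sat_fBigAnd; split=> H j; have := H j; rewrite sat_rename;
    by apply: iffLR; apply: eq_sat => -[].
split=> [[/blockE Dw dw]|[a aw Da]].
  have [a aw] := choice (fun j => domain_iso hI (Dw j)).
  by exists a => //; apply/(deltaE a).
split; last exact/(deltaE a).
by apply/blockE => j; apply: (iso_domain hI (aw j)).
Qed.

Lemma blocks_rep_domain B a (w : 'I_(r * q) -> host IJ B) :
  blocks_rep a w -> domain w <-> domain a.
Proof.
move=> aw; rewrite composite_domain; split=> [[a' aw']|Da]; last by exists a.
by rewrite (blocks_rep_inj aw aw').
Qed.

Lemma blocks_rep_equivalent B a a' (w w' : 'I_(r * q) -> host IJ B) :
  blocks_rep a w -> blocks_rep a' w' -> equivalent w w' <-> equivalent a a'.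
Proof.
move=> aw aw'; rewrite /equivalent -(translate_blocksP (epsilon J)
  (a := join a a') (e := join w w')
  (place := fun x k => match x with
                      | inl j => inl (block_index j k)
                      | inr j => inr (block_index j k)
                      end)) //.
by case=> j; [apply: aw | apply: aw'].
Qed.

(** One direction lifts tuples of [J] to representatives, which always exist; the other reads off
    the tuples represented, which are unique. *)
Lemma blocks_rep_class_invariant B m
    (P : set ('I_m -> 'I_(r * q) -> host IJ B))
    (Q : set ('I_m -> 'I_q -> host J B)) :
  (forall w a, (forall i, domain (w i)) ->
    (forall i, blocks_rep (a i) (w i)) -> P w <-> Q a) ->
  class_invariant P <-> class_invariant Q.
Proof.
move=> PQ; split=> inv i.
  move=> a a' Da Da' aa' aa'i.
  (* The representative is chosen as a function of the q-tuple, so arguments on which [a] and [a']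
     agree get the same representative. *)
  have [w wP] := choice (@blocks_rep_surj B).
  have Dwa j : domain (w (a j)) by apply/(blocks_rep_domain (wP _)).
  have Dwa' j : domain (w (a' j)) by apply/(blocks_rep_domain (wP _)).
  rewrite -(PQ (w \o a)) // -(PQ (w \o a')) //.
  apply: (inv i) => // [j /aa' /= -> //|].
  exact/(blocks_rep_equivalent (wP _) (wP _)).
move=> w w' Dw Dw' ww' ww'i.
have repE (x : 'I_m -> 'I_(r * q) -> host IJ B) : (forall j, domain (x j)) ->
    exists a : 'I_m -> 'I_q -> host J B, forall j, blocks_rep (a j) (x j).
  move=> Dx.
  suff /choice[a] : forall j, exists a, blocks_rep a (x j) by exists a.
  by move=> j; have /composite_domain[a] := Dx j; exists a.
have [a aw] := repE w Dw; have [a' aw'] := repE w' Dw'.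
rewrite (PQ w a) // (PQ w' a') //; apply: (inv i) => [j|j|j /ww' wj|].
- exact/(blocks_rep_domain (aw j)).
- exact/(blocks_rep_domain (aw' j)).
- by apply: blocks_rep_inj (aw j) _; rewrite wj.
- exact/(blocks_rep_equivalent (aw i) (aw' i)).
Qed.

Lemma composite_relP B (R : symbol L'') (a : 'I_(arity R) -> 'I_q -> host J B)
    (w : 'I_(arity R) -> 'I_(r * q) -> host IJ B) :
  (forall i, blocks_rep (a i) (w i)) ->
  holds (rel_formula IJ R) w <-> holds (rel_formula J R) a.
Proof. by move=> aw; apply: translate_blocksP => -[i j]; apply: aw. Qed.

(** * The interpretation axioms for the composite *)

Lemma composite_iso_eclass B (b : val B) a (w : 'I_(r * q) -> host IJ B) :
  iso J b a -> blocks_rep a w -> iso IJ b = eclass w.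
Proof.
move=> ba aw; apply/seteqP; split=> x.
  move=> [a' [ba' a'x]]; split.
    by apply/composite_domain; exists a' => //; apply: iso_domain ba'.
  by apply/(blocks_rep_equivalent aw a'x)/(iso_equivalent hJ ba ba').
move=> [/composite_domain[a' a'x Da'] wx]; exists a'; split=> //.
by apply: (iso_transfer hJ ba Da'); apply/(blocks_rep_equivalent aw a'x).
Qed.

Lemma composite_is_interpretation : is_interpretation IJ.
Proof.
have isoE B (b : val B) : exists a, exists w,
    iso J b a /\ @blocks_rep B a w.
  have [a ba] := iso_nonempty hJ b; have [w aw] := blocks_rep_surj a.
  by exists a, w.
split.
- by rewrite muln_gt0 (arity_gt0 hI) (arity_gt0 hJ).
- by move=> B B' /(alpha_inj hI) /(alpha_inj hJ).
- move=> B u /composite_domain[a au Da].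
  by apply/(blocks_rep_equivalent au au); apply: equivalent_refl hJ _ _ Da.
- move=> B u v /composite_domain[a au Da] /composite_domain[b bv Db].
  move=> /(blocks_rep_equivalent au bv) ab.
  apply/(blocks_rep_equivalent bv au).
  exact: equivalent_sym hJ _ _ _ Da Db ab.
- move=> B u v w /composite_domain[a au Da] /composite_domain[b bv Db].
  move=> /composite_domain[c cw Dc] /(blocks_rep_equivalent au bv) ab.
  move=> /(blocks_rep_equivalent bv cw) bc.
  apply/(blocks_rep_equivalent au cw).
  exact: equivalent_trans hJ _ _ _ _ Da Db Dc ab bc.
- move=> B R; apply/blocks_rep_class_invariant; last first.
    exact: (rel_formula_invariant hJ (A := B) (R := R)).
  by move=> w a _; apply: composite_relP.
- move=> B; split.
  + move=> b _; have [a [w [ba aw]]] := isoE B b; exists w.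
      by apply/(blocks_rep_domain aw); apply: iso_domain ba.
    by rewrite (composite_iso_eclass ba aw).
  + move=> b b' _ _ bb'; have [a [w [ba aw]]] := isoE B b.
    have : iso IJ b w by exists a.
    rewrite bb' => -[a' [ba' aw']]; apply: (iso_inj hJ ba).
    by rewrite (blocks_rep_inj aw aw').
  + move=> _ [w /composite_domain[a aw Da] <-].
    have [b ba] := domain_iso hJ Da.
    by exists b => //; apply: composite_iso_eclass aw.
- move=> B R b; rewrite (iso_rel hJ); split=> [[a [ba ha]]|[w [bw hw]]].
    have [w aw] := choice (fun i => blocks_rep_surj (a i)).
    exists w; split; last exact/(composite_relP aw).
    by move=> i; exists (a i); split; [apply: ba | apply: aw].
  have [a aw] := choice bw; exists a.
  split=> [i|]; first by have [] := aw i.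
  by apply/(composite_relP (w := w)) => // i; have [] := aw i.
Qed.

(** * Quotient-trace reflection of the composite *)

Context (qI : quotient_trace_reflecting I).
Context (qJ : quotient_trace_reflecting J).

Lemma composite_quotient_trace_reflecting : quotient_trace_reflecting IJ.
Proof.
move=> m rho inv_rho.
have hIJ := composite_is_interpretation.
have [g _ gK] := @block_index_bij r q.
(* The [m] composite tuples have [q] blocks each; pairs (tuple, block) are numbered by [enum_rank],
   because reflection for [I] is stated for arguments indexed by an ordinal. *)
pose n := #|{: 'I_m * 'I_q}|.
pose rho_blocks : formula L ('I_n * 'I_r + 'I_s) :=
  rename (fun z : 'I_m * 'I_(r * q) + 'I_s => match z with
            | inl (i, k) => inl (enum_rank (i, (g k).1), (g k).2)
            | inr l => inr l
            end) rho.
have [sigma sigmaP] := qI (saturate_invariant (I := I) rho_blocks hI).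
pose tau : formula L' ('I_m * 'I_q + 'I_0) :=
  rename (fun x : 'I_n => inl (enum_val x)) sigma.
(* Only [w] in the composite domain is considered, since the invariance of [rho] is known only
   there. *)
have tauP B (w : 'I_m -> 'I_(r * q) -> host IJ B) a :
    (forall i, domain (w i)) ->
    (forall i, blocks_rep (a i) (w i)) -> holds rho w <-> holds tau a.
  move=> Dw aw.
  pose v (x : 'I_n) := block (w (enum_val x).1) (enum_val x).2.
  pose c (x : 'I_n) := a (enum_val x).1 (enum_val x).2.
  have cv x : @iso _ _ _ _ _ _ I (alpha J B) (c x) (v x) by apply: aw.
  have -> : holds tau a <-> sat (host J B) sigma c.
    by rewrite /holds sat_rename; apply: eq_sat.
  rewrite (sigmaP (alpha J B) c v cv) holds_saturate.
  have rho_blocksE (w' : 'I_m -> 'I_(r * q) -> host IJ B)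
      (v' : 'I_n -> 'I_r -> host I (alpha J B)) :
      (forall i j, block (w' i) j = v' (enum_rank (i, j))) ->
      holds rho_blocks v' <-> holds rho w'.
    move=> wv'; rewrite /holds sat_rename; apply: eq_sat => -[[i k]|//] /=.
    by rewrite -wv' /block gK.
  split=> [hw|[v' [vv' hv']]].
    (* By reflexivity the blocks of [w] themselves witness the saturation. *)
    exists v; split; last first.
      by apply/(rho_blocksE w) => // i j; rewrite /v enum_rankK.
    move=> x; have Dvx := iso_domain hI (cv x).
    by split=> //; apply: equivalent_refl hI _ _ Dvx.
  (* The witnessing blocks are glued into tuples [w']. They are equivalent to the blocks of [w], so
     [w'] represents the same [a], and the composite invariance of [rho] passes from [w'] to [w]. *)
  have [w' w'v'] := choice (fun i : 'I_m =>
    block_surj (fun j : 'I_q => v' (enum_rank (i, j)))).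
  have aw' i : blocks_rep (a i) (w' i).
    move=> j; rewrite w'v'; have [Dv' vv'x] := vv' (enum_rank (i, j)).
    by apply: (iso_transfer hI _ Dv' vv'x); rewrite /v enum_rankK; apply: aw.
  move: hv'; rewrite (rho_blocksE w') //; apply: iffLR.
  apply: (class_invariant_all (inv_rho B)) => // i.
    by apply/(blocks_rep_domain (aw' i))/(blocks_rep_domain (aw i)).
  apply/(blocks_rep_equivalent (aw' i) (aw i)).
  apply: equivalent_refl hJ _ _ _.
  exact/(blocks_rep_domain (aw i)).
have [|rho_down rho_downP] := qJ (rho := tau).
  move=> B; apply/(blocks_rep_class_invariant (tauP B)).
  exact: inv_rho.
exists rho_down => B b w bw.
have [a aw] := choice bw.
rewrite (rho_downP B b a); last by move=> i; have [] := aw i.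
rewrite -(tauP B w a) //.
- by move=> i; apply: iso_domain (bw i).
- by move=> i; have [] := aw i.
Qed.

End Composite.

Theorem theorem8p27 (L L' L'' : language) (C : set (structure L))
    (D : set (structure L')) (E : set (structure L'')) (r s q : nat)
    (I : interp C D r s) (J : interp D E q 0) :
  is_interpretation I -> is_interpretation J ->
  quotient_trace_reflecting I -> quotient_trace_reflecting J ->
  is_interpretation (composite I J : interp C E (r * q) s) /\
  quotient_trace_reflecting (composite I J).
Proof.
move=> hI hJ qI qJ; split; first exact: composite_is_interpretation.
exact: composite_quotient_trace_reflecting.
Qed.
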